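(* Let $D$ and $F$ be disjoint finite subsets of $Q$. Then $$\lim_{N-t-j\to\infty}P_N\left(X^N_{q+(-t,j)}=1\ \forall q\in D\text{ and }X^N_{r+(-t,j)}=0\ \forall r\in F\ \middle|\ X^N_{(-t,j)}=1\right)=P_\infty\left(X_q=1\ \forall q\in D\text{ and }X_r=0\ \forall r\in F\right),$$ where the limit is over positive integers $N,t,j$ with $N-t-j\to\infty$.
   Context: $\mathbb{N}$ denotes the positive integers. $S_N(312)$ is the set of permutations $\sigma=\sigma_1\ldots\sigma_N$ of $1,\dots,N$ for which there are no indices $i_1<i_2<i_3$ with $\sigma_{i_1}>\sigma_{i_3}>\sigma_{i_2}$; $P_N$ is the uniform probability distribution on $S_N(312)$. $Q=\{(-i,j):i,j\in\mathbb{N}\}$, $W_N=[-N,-1]\times[1,N]$. For each $N$, $X^N_{(-i,j)}=1$ if $(-i,j)\in W_N$ and $\sigma_{N-i+1}=j$, and $X^N_{(-i,j)}=0$ otherwise, where $\sigma$ has distribution $P_N$. $\{X_q:q\in Q\}$ is the collection of $\{0,1\}$-valued random variables, with joint distribution $P_\infty$, such that for every finite $C\subset Q$, $\{X^N_q:q\in C\}$ converges in distribution to $\{X_q:q\in C\}$ as $N\to\infty$ (such a collection exists). *)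

(* Defs.v *)
From HB Require Import structures.
From mathcomp Require Import all_boot all_order all_algebra all_fingroup.
From mathcomp Require Import finmap.
From mathcomp Require Import all_classical all_reals all_analysis.

Set Implicit Arguments.
Unset Strict Implicit.
Unset Printing Implicit Defensive.
Import Order.TTheory GRing.Theory Num.Theory.
Import numFieldNormedType.Exports.
Local Open Scope classical_set_scope.
Local Open Scope ring_scope.

Definition avoids312 (N : nat) (s : 'S_N) : bool :=
  ~~ [exists i1 : 'I_N, exists i2 : 'I_N, exists i3 : 'I_N,
       [&& (i1 < i2)%N, (i2 < i3)%N, (s i2 < s i3)%N & (s i3 < s i1)%N]].

Definition S312 (N : nat) : {set 'S_N} := [set s : 'S_N | avoids312 s]%SET.

Definition expectN (R : realType) (N : nat) (f : 'S_N -> R) : R :=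
  (\sum_(s in S312 N) f s) / #|S312 N|%:R.

Definition probN (R : realType) (N : nat) (A : pred 'S_N) : R :=
  #|[set s in S312 N | A s]%SET|%:R / #|S312 N|%:R.

(* The junk value when [B] has probability 0 is 0. *)
Definition cond_probN (R : realType) (N : nat) (A B : pred 'S_N) : R :=
  probN R [pred s | A s && B s] / probN R B.

Definition inQ (q : int * int) : bool := (q.1 < 0) && (0 < q.2).

Definition Qpt : Type := {q : int * int | inQ q}.
HB.instance Definition _ := Choice.on Qpt.
HB.instance Definition _ := SubType.on Qpt.

Definition inW (N : nat) (q : int * int) : bool :=
  [&& - N%:Z <= q.1, q.1 <= -1, 1 <= q.2 & q.2 <= N%:Z].

(* The permutation [s] acts on {0, ..., N-1}: position [k] and value [s k]
   stand for position [k + 1] and value [s k + 1] of a permutation of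
   {1, ..., N}.  For q = (-i, j), the sum N + q.1 + 1 is the position
   N - i + 1. *)
Definition XN (N : nat) (s : 'S_N) (q : int * int) : bool :=
  inW N q && [exists k : 'I_N,
    ((k : nat)%:Z + 1 == N%:Z + q.1 + 1) && ((s k : nat)%:Z + 1 == q.2)].

(* For every finite set C of points, (X^N_q)_{q in C} converges in distribution
   to (X_q)_{q in C}.  These vectors live in the finite discrete space
   {0,1}^C, on which every real function is bounded and continuous. *)
Definition cvg_in_distribution_XN (R : realType) (d : measure_display)
    (T : measurableType d) (P : probability T R)
    (X : Qpt -> {RV P >-> bool}) : Prop :=
  forall (C : {fset Qpt}) (g : {ffun C -> bool} -> R),
    (expectN (fun s : 'S_N => g [ffun q : C => XN s (val (val q))]))
      @[N --> \oo]
    --> fine ('E_P[fun w => g [ffun q : C => X (val q) w]])%E.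

(* The filter on triples (N, t, j) of positive integers with
   N - t - j tending to infinity. *)
Definition gap_to_infinity : set_system (nat * nat * nat) :=
  filter_from [set: nat] (fun M => [set x : nat * nat * nat |
    let: (N, t, j) := x in
    [/\ (0 < N)%N, (0 < t)%N, (0 < j)%N & M%:Z <= N%:Z - t%:Z - j%:Z]]).

Global Instance gap_to_infinity_proper : ProperFilter gap_to_infinity.
Proof.
apply: filter_from_proper.
- apply: filter_from_filter; first by exists 0%N.
  move=> M1 M2 _ _; exists (maxn M1 M2) => //.
  move=> [[N t] j] /= [N0 t0 j0 h]; split; split=> //; apply: le_trans h.
    by rewrite lez_nat leq_maxl.
  by rewrite lez_nat leq_maxr.
- move=> M _; exists (M + 1 + 1, 1, 1)%N => /=; split=> //.
    by rewrite addn1.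
  by rewrite !PoszD !addrK.
Qed.

(* Main.v *)
Require Import Defs.
From mathcomp Require Import all_boot all_order all_algebra all_fingroup.
From mathcomp Require Import finmap.
From mathcomp Require Import all_classical all_reals all_analysis.
From mathcomp Require Import zify.
Import Order.TTheory GRing.Theory Num.Theory.
Import numFieldNormedType.Exports.
Local Open Scope classical_set_scope.
Local Open Scope ring_scope.

(** The theorem is local: conditioning on an entry j at position p of a
312-avoiding permutation freezes the shape of everything above and to the left
of that entry.  Positions and values are counted from 0 below, so that the
conditioned entry has position p = N - t and value b = j - 1.

Let s avoid 312 with s(p) = b, and look at the positions before p.  If x < y < p
and s(x) > b > s(y), then x, y, p carry the pattern 312; so the entries above b
occupy a final segment [o, p) of [0, p).  If x lies in that segment and a value
c with b < c < s(x) were taken after p, then x, p and the position of c would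
carry 312; so the values on [o, p) are exactly b + 1, ..., b + m, where
m = p - o.  Everything that the shifted window sees is therefore a block of
size m that is itself a 312-avoiding permutation (corner_block, XN_block).

Conversely this block can be replaced by any other 312-avoiding permutation of
size m without creating a 312 pattern (glue_corner).  Hence, given o, the block
is uniform on S_m(312), and the conditional probability of the event is exactly
its unconditional probability under P_m (card_block_event).

Finally, the o entries before the block are distinct values smaller than b,
whence o <= b and m >= p - b = N - t - j + 1 (corner_le): the size of the block
goes to infinity with N - t - j, not just in probability but surely.  The
conditional probability is thus a convex combination of the numbers P_m(event)
with m >= N - t - j + 1, each of which is close to the limit
(probN_window_cvg, cond_count_close). *)

(** * Permutations as functions on the natural numbers *)

(** Extending a permutation of [0, n) by the identity gives a bijection of nat
with the same 312 patterns, so that positions can be shifted and compared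
without bound proofs. *)
Definition natfun {n : nat} (s : 'S_n) (k : nat) : nat :=
  if insub k is Some i then s i else k.

Lemma natfun_ord {n : nat} (s : 'S_n) (i : 'I_n) : natfun s i = s i.
Proof. by rewrite /natfun valK. Qed.

Lemma natfun_ge {n : nat} (s : 'S_n) {k : nat} : (n <= k)%N -> natfun s k = k.
Proof. by move=> h; rewrite /natfun insubN // -leqNgt. Qed.

Lemma natfun_lt {n : nat} (s : 'S_n) {k : nat} : (k < n)%N -> (natfun s k < n)%N.
Proof. by move=> h; rewrite (natfun_ord s (Ordinal h)). Qed.

Lemma natfun_inj {n : nat} (s : 'S_n) : injective (natfun s).
Proof.
move=> x y; have [xn|xn] := ltnP x n; have [yn|yn] := ltnP y n.
- rewrite (natfun_ord s (Ordinal xn)) (natfun_ord s (Ordinal yn)).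
  by move=> /val_inj/perm_inj[].
- by rewrite (natfun_ge s yn) => e; have := natfun_lt s xn; rewrite e ltnNge yn.
- by rewrite (natfun_ge s xn) => e; have := natfun_lt s yn; rewrite -e ltnNge xn.
- by rewrite !natfun_ge.
Qed.

Lemma natfun_surj {n : nat} (s : 'S_n) (c : nat) : exists k, natfun s k = c.
Proof.
have [cn|cn] := ltnP c n; last by exists c; rewrite natfun_ge.
by exists ((s^-1)%g (Ordinal cn)); rewrite natfun_ord permKV.
Qed.

Lemma eq_natfun {n : nat} (s t : 'S_n) :
  (forall k, (k < n)%N -> natfun s k = natfun t k) -> s = t.
Proof.
by move=> h; apply/permP => i; apply/ord_inj; rewrite -!natfun_ord h.
Qed.

Definition avoids (f : nat -> nat) : Prop := forall x y z : nat,
  (x < y)%N -> (y < z)%N -> (f y < f z)%N -> (f z < f x)%N -> False.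

(** Only patterns inside [0, n) matter, for the extension fixes all other
points. *)
Lemma S312I {n : nat} (s : 'S_n) :
  (forall x y z, (x < y)%N -> (y < z)%N -> (z < n)%N ->
     (natfun s y < natfun s z)%N -> (natfun s z < natfun s x)%N -> False) ->
  s \in S312 n.
Proof.
move=> h; rewrite inE; apply/existsPn => x; apply/existsPn => y.
apply/existsPn => z; apply/negP => /and4P[xy yz yz' zx].
by apply: (h x y z) => //; rewrite !natfun_ord.
Qed.

Lemma avoids312P {n : nat} (s : 'S_n) : reflect (avoids (natfun s)) (s \in S312 n).
Proof.
apply: (iffP idP) => [|h].
  rewrite inE => /existsPn h x y z xy yz yz' zx.
  have [zn|zn] := ltnP z n; last first.
    have [xn|xn] := ltnP x n; last by rewrite !(natfun_ge s) // in zx; lia.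
    by have := natfun_lt s xn; rewrite (natfun_ge s zn) // in zx; lia.
  have yn := ltn_trans yz zn; have xn := ltn_trans xy yn.
  have /existsPn/(_ (Ordinal yn))/existsPn/(_ (Ordinal zn)) := h (Ordinal xn).
  by rewrite -!natfun_ord /= xy yz yz' zx.
by apply: S312I => x y z xy yz _; exact: h.
Qed.

Lemma S312_gt0 (n : nat) : (0 < #|S312 n|)%N.
Proof.
apply/card_gt0P; exists 1%g; apply: S312I => x y z xy yz zn.
have natfun1 k : natfun (1 : 'S_n)%g k = k.
  have [kn|] := ltnP k n; last exact: natfun_ge.
  by rewrite (natfun_ord _ (Ordinal kn)) perm1.
by rewrite !natfun1; lia.
Qed.

(** The identity is a default value, taken when f does not restrict to a
permutation of [0, n). *)
Definition perm_of_natfun (n : nat) (f : nat -> nat) : 'S_n :=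
  odflt 1%g [pick s : 'S_n | [forall k : 'I_n, s k == f k :> nat]].

Lemma perm_of_natfunE (n : nat) (f : nat -> nat) :
  (forall x y, (x < n)%N -> (y < n)%N -> f x = f y -> x = y) ->
  (forall x, (x < n)%N -> (f x < n)%N) ->
  forall k, (k < n)%N -> natfun (perm_of_natfun n f) k = f k.
Proof.
move=> f_inj f_lt k kn; rewrite /perm_of_natfun; case: pickP => [s|none].
  by move=> /forallP/(_ (Ordinal kn))/eqP <-; rewrite -natfun_ord.
pose g (i : 'I_n) := Ordinal (f_lt i (ltn_ord i)).
have g_inj : injective g.
  by move=> i i' /(congr1 val)/= /f_inj e; apply/val_inj/e.
by have /forallP[] := none (perm g_inj); move=> i; rewrite permE.
Qed.

(** * The block above and to the left of an entry *)

Section Corner.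
Context {p b o : nat}.
Let m := (p - o)%N.

(** The last field says that, among the positions before p, those from o on carry
the values above b. *)
Record corner (f : nat -> nat) : Prop := Corner {
  corner_avoids : avoids f;
  corner_at : f p = b;
  corner_before : forall x, (x < p)%N -> (b < f x)%N = (o <= x)%N }.

Hypothesis op : (o <= p)%N.

(** The first o values are distinct and smaller than b.  This is what forces the
block to be large. *)
Lemma corner_le {f} : injective f -> corner f -> (o <= b)%N.
Proof.
move=> f_inj [_ fp fb].
rewrite -(size_iota 0 o) -(size_map f) -[leqRHS](size_iota 0 b).
apply: uniq_leq_size; first by rewrite map_inj_uniq ?iota_uniq.
move=> _ /mapP[x + ->]; rewrite !mem_iota => xo.
have xp : (x < p)%N by lia.
have := fb x xp; have : f x <> f p by move=> /f_inj; lia.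
lia.
Qed.

(** The values on [o, p) are downward closed among the values above b, since a
skipped value would occur after p and complete a 312 pattern; and there are m
of them. *)
Lemma corner_block {f} : injective f -> (forall c, exists k, f k = c) ->
  corner f -> forall k, (b < f k <= b + m)%N = (o <= k < p)%N.
Proof.
move=> f_inj f_surj [fav fp fb].
(* A value c between b and f x that occurs at y > p makes x, p, y a 312
   pattern. *)
have down x c : (o <= x < p)%N -> (b < c <= f x)%N ->
    exists2 y, (o <= y < p)%N & f y = c.
  move=> xop; have [y <-] := f_surj c => /andP[by_ yx]; exists y => //.
  have [yp|py|yp] := ltngtP y p; first by rewrite -fb ?by_.
    exfalso; apply: (fav x p y); rewrite ?fp //; first by lia.
    rewrite ltn_neqAle yx andbT; apply/eqP => /f_inj; lia.
  by rewrite yp fp ltnn in by_.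
(* Otherwise the m + 1 values from b + 1 to b + 1 + m all occur on [o, p). *)
have up x : (o <= x < p)%N -> (b < f x <= b + m)%N.
  move=> xop; suff : (f x <= b + m)%N by have := fb x; lia.
  rewrite leqNgt; apply/negP => big.
  suff : (m.+1 <= m)%N by rewrite ltnn.
  have : (size (iota b.+1 m.+1) <= size (map f (iota o m)))%N.
    apply: uniq_leq_size; first exact: iota_uniq.
    move=> c; rewrite mem_iota => hc.
    have [|y yop <-] := down x c xop; first by lia.
    by apply: map_f; rewrite mem_iota; lia.
  by rewrite size_map !size_iota.
move=> k; apply/idP/idP; last exact: up.
move=> hk.
(* m distinct values inside an interval of length m fill it. *)
have sub : {subset map f (iota o m) <= iota b.+1 m}.
  move=> _ /mapP[x + ->]; rewrite !mem_iota => hx.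
  by have := up x; lia.
have [||_ e] := uniq_min_size _ sub _.
- by rewrite map_inj_uniq ?iota_uniq.
- by rewrite size_map !size_iota.
have : f k \in map f (iota o m) by rewrite e mem_iota; lia.
by rewrite mem_map // mem_iota; lia.
Qed.

Definition glue (f h : nat -> nat) (k : nat) : nat :=
  if (o <= k < p)%N then (b.+1 + h (k - o))%N else f k.

Section Glue.
Variables f h : nat -> nat.
Hypothesis f_inj : injective f.
Hypothesis f_surj : forall c, exists k, f k = c.
Hypothesis f_corner : corner f.
Hypothesis h_inj : injective h.
Hypothesis h_lt : forall x, (x < m)%N -> (h x < m)%N.

Let blockP := corner_block f_inj f_surj f_corner.

Lemma glue_inj : injective (glue f h).
Proof.
move=> x y; rewrite /glue; have := blockP x; have := blockP y.
have := @h_lt (x - o)%N; have := @h_lt (y - o)%N.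
case: ifP => xb; case: ifP => yb; try lia.
- by move=> _ _ _ _ e; have := h_inj (x - o)%N (y - o)%N; lia.
- by move=> _ _ _ _ /f_inj.
Qed.

Lemma glue_in_block k :
  (o <= k < p)%N -> exists2 l, (o <= l < p)%N & glue f h k = f l.
Proof.
move=> kb; rewrite /glue kb; have [l e] := f_surj (b.+1 + h (k - o)).
by exists l => //; have := @h_lt (k - o)%N; rewrite -blockP e; lia.
Qed.

(** A 312 pattern of the new function has all three entries in the block, which
h forbids, or at most one, in which case the same positions carry 312 in f, or
exactly two.  In the last case, as the block is an interval of positions and
of values, those two can only play 1 and 2, and the third entry is then above
the block and before it, where all values are below b. *)
Lemma glue_corner : avoids h -> corner (glue f h).
Proof.
move=> h_av; have [f_av fp fb] := f_corner; split.
- move=> x y z xy yz; rewrite /glue.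
  have := blockP x; have := blockP y; have := blockP z.
  have := @h_lt (x - o)%N; have := @h_lt (y - o)%N; have := @h_lt (z - o)%N.
  have := fb x; have := f_av x y z xy yz.
  have := h_av (x - o)%N (y - o)%N (z - o)%N.
  by case: ifP => xb; case: ifP => yb; case: ifP => zb; lia.
- by rewrite /glue ltnn andbF.
- move=> x xp; rewrite /glue xp andbT.
  by case: ifP => // ox; [lia | rewrite fb].
Qed.

End Glue.

End Corner.

(** * Uniformity of the block *)

(** The start o of the block is a function of the permutation, which makes the
sets below the parts of a partition. *)
Definition head_length (p b : nat) (f : nat -> nat) : nat :=
  find (fun x => b < f x)%N (iota 0 p).

Lemma head_length_le (p b : nat) (f : nat -> nat) :
  (head_length p b f <= p)%N.
Proof. by rewrite -[leqRHS](size_iota 0 p) find_size. Qed.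

Definition corner_set (N p b o : nat) : {set 'S_N} :=
  [set s in S312 N | (natfun s p == b) && (head_length p b (natfun s) == o)]%SET.

Lemma corner_setP {N p b o : nat} (op : (o <= p)%N) (s : 'S_N) :
  reflect (@corner p b o (natfun s)) (s \in corner_set N p b o).
Proof.
rewrite inE; apply: (iffP and3P) => [[/avoids312P av /eqP sp /eqP ho]|].
  split=> // x xp; apply/idP/idP => [bx|ox].
    rewrite leqNgt; apply/negP; rewrite -ho => /(before_find 0%N).
    by rewrite nth_iota // bx.
  have hasb : has (fun x => b < natfun s x)%N (iota 0 p).
    by rewrite has_find -/(head_length p b (natfun s)) ho size_iota; lia.
  have := nth_find 0%N hasb; rewrite -/(head_length p b (natfun s)) ho nth_iota; last lia.
  rewrite add0n => bo; have := av o x p; have : natfun s x <> natfun s p.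
    by move=> /natfun_inj; lia.
  have : (o = x) \/ (o < x)%N by lia.
  by case=> [<- //|]; lia.
move=> [av sp sb]; split; [exact/avoids312P | exact/eqP | ].
rewrite eqn_leq; apply/andP; split.
  rewrite leqNgt; apply/negP => oh.
  have := before_find 0%N oh; have := head_length_le p b (natfun s) => hp.
  by rewrite nth_iota ?add0n ?sb ?leqnn; lia.
have [hp|] := ltnP (head_length p b (natfun s)) p; last exact: leq_trans.
rewrite -sb //; move: (hp); rewrite /head_length.
rewrite -[X in (_ < X)%N -> _](size_iota 0 p) -has_find.
by move=> /(nth_find 0%N); rewrite nth_iota.
Qed.

Definition block {N : nat} (p b o : nat) (s : 'S_N) : 'S_(p - o) :=
  perm_of_natfun (p - o) (fun x => natfun s (o + x) - b.+1)%N.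

Definition glue_perm {N : nat} (p b o : nat) (s : 'S_N) (t : 'S_(p - o)) : 'S_N :=
  perm_of_natfun N (@glue p b o (natfun s) (natfun t)).

Section CornerSet.
Context {N p b o : nat} (op : (o <= p)%N) (pN : (p < N)%N).
Implicit Types (s : 'S_N) (t : 'S_(p - o)).

Lemma natfun_block s x : s \in corner_set N p b o -> (x < p - o)%N ->
  natfun (block p b o s) x = (natfun s (o + x) - b.+1)%N.
Proof.
move=> /(corner_setP op) sc xm.
have bl := corner_block op (@natfun_inj _ s) (natfun_surj s) sc.
rewrite perm_of_natfunE // => {x xm}[x y xm ym e|x xm].
  have := bl (o + x)%N; have := bl (o + y)%N.
  by have := @natfun_inj _ s (o + x)%N (o + y)%N; lia.
have := bl (o + x)%N; lia.
Qed.

Lemma block_avoids s :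
  s \in corner_set N p b o -> block p b o s \in S312 (p - o).
Proof.
move=> sc; apply: S312I => x y z xy yz zm.
rewrite !natfun_block //; try lia.
have [av _ _] := elimT (corner_setP op s) sc.
have := av (o + x)%N (o + y)%N (o + z)%N; lia.
Qed.

Lemma natfun_glue s t k : s \in corner_set N p b o ->
  natfun (glue_perm p b o s t) k = @glue p b o (natfun s) (natfun t) k.
Proof.
move=> /(corner_setP op) sc; have [kN|Nk] := ltnP k N; last first.
  by rewrite /glue ifF ?natfun_ge //; lia.
rewrite perm_of_natfunE // => {kN k}[x y _ _|x xN].
  by apply: glue_inj => //; [exact: natfun_inj|exact: natfun_surj|exact: natfun_inj|
    move=> z; exact: natfun_lt].
have [xb|xb] := boolP (o <= x < p)%N; last by rewrite /glue (negbTE xb) natfun_lt.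
have [|||z|l lb ->] := @glue_in_block p b o op (natfun s) (natfun t) _ _ _ _ x xb => //.
- exact: natfun_inj.
- exact: natfun_surj.
- exact: natfun_lt.
- by apply: natfun_lt; lia.
Qed.

Lemma glue_corner_set s t : s \in corner_set N p b o -> t \in S312 (p - o) ->
  glue_perm p b o s t \in corner_set N p b o.
Proof.
move=> sc /avoids312P tav; apply/(corner_setP op).
have -> : natfun (glue_perm p b o s t) = @glue p b o (natfun s) (natfun t).
  by apply/funext => k; rewrite natfun_glue.
apply: glue_corner => //; [exact: natfun_inj|exact: natfun_surj|
  exact/(corner_setP op)|by move=> z; exact: natfun_lt].
Qed.

Lemma block_glue s t : s \in corner_set N p b o -> t \in S312 (p - o) ->
  block p b o (glue_perm p b o s t) = t.
Proof.
move=> sc tav; apply: eq_natfun => x xm.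
rewrite natfun_block ?glue_corner_set // natfun_glue // /glue ifT; last lia.
by rewrite !addKn.
Qed.

Lemma glue_glue_block s t : s \in corner_set N p b o -> t \in S312 (p - o) ->
  glue_perm p b o (glue_perm p b o s t) (block p b o s) = s.
Proof.
move=> sc tav; apply: eq_natfun => k kN.
rewrite natfun_glue ?glue_corner_set // /glue; case: ifP => kb; last first.
  by rewrite natfun_glue // /glue kb.
have bl := corner_block op (@natfun_inj _ s) (natfun_surj s)
  (elimT (corner_setP op s) sc).
rewrite natfun_block //; last lia.
by rewrite subnKC; [|have := bl k]; rewrite subnKC; lia.
Qed.

(** Given o, the block is uniformly distributed on S_m(312).  Exchanging the block
of s with t is an involution of pairs (s, t), and it carries the pairs whose
block of s lies in A onto the pairs with t in A. *)
Lemma card_block_event (A : pred 'S_(p - o)) :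
  (#|[set s in corner_set N p b o | A (block p b o s)]%SET| * #|S312 (p - o)| =
   #|corner_set N p b o| * #|[set t in S312 (p - o) | A t]%SET|)%N.
Proof.
rewrite -!cardsX.
pose swap (u : 'S_N * 'S_(p - o)) := (glue_perm p b o u.1 u.2, block p b o u.1).
have swapK u : u.1 \in corner_set N p b o -> u.2 \in S312 (p - o) ->
    swap (swap u) = u.
  by case: u => s t /= sc tav; rewrite /swap /= block_glue // glue_glue_block.
rewrite -(@card_in_imset _ _ swap); last first.
  move=> [s t] [s' t']; rewrite !finset.in_setX => /andP[/setIdP[sc _] tav].
  by move=> /andP[/setIdP[sc' _] tav'] e; rewrite -(swapK (s, t)) // e swapK.
congr #|pred_of_set _|; apply/setP => -[s t]; apply/imsetP/idP.
  move=> [[s' t'] + ->]; rewrite !finset.in_setX => /andP[/setIdP[sc As] tav].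
  by rewrite glue_corner_set //=; apply/setIdP; rewrite block_avoids.
rewrite finset.in_setX => /andP[sc /setIdP[tav At]]; exists (swap (s, t)).
  rewrite finset.in_setX /= block_avoids // andbT; apply/setIdP.
  by rewrite glue_corner_set // block_glue.
by rewrite swapK.
Qed.

End CornerSet.

(** * Translation to the indicators X^N *)

Lemma XNE {n : nat} (s : 'S_n) (i k : nat) : (0 < i)%N -> (0 < k)%N ->
  XN s (- i%:Z, k%:Z) = (i <= n)%N && (natfun s (n - i) == k.-1).
Proof.
move=> i0 k0; apply/andP/andP => [[/and4P[/= h1 h2 h3 h4] /existsP[l]]|].
  move=> /andP[/eqP hl /eqP hs]; split; first by lia.
  by have -> : (n - i)%N = l by [lia]; rewrite natfun_ord; lia.
move=> [i_n /eqP e]; have lt : (n - i < n)%N by lia.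
have := natfun_lt s lt => ltv; split; first by rewrite /inW /=; lia.
apply/existsP; exists (Ordinal lt); rewrite -natfun_ord /= e; lia.
Qed.

Lemma inQP (q : Qpt) :
  exists i k : nat, [/\ (0 < i)%N, (0 < k)%N & val q = (- i%:Z, k%:Z)].
Proof.
case: q => -[q1 q2] /=; rewrite /inQ /= => /andP[h1 h2].
exists `|q1|%N, `|q2|%N; split; try lia.
by congr pair; lia.
Qed.

(** Seen from the conditioned entry, the permutation looks like its block: within
the block by definition, and farther to the left both indicators vanish, as
the values there are below b. *)
Lemma XN_block {N t j o : nat} (s : 'S_N) (q : Qpt) :
  (0 < t <= N)%N -> (0 < j)%N -> (o <= N - t)%N ->
  s \in corner_set N (N - t) j.-1 o ->
  XN s (val q + (- t%:Z, j%:Z)) = XN (block (N - t) j.-1 o s) (val q).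
Proof.
move=> /andP[t0 tN] j0 op sc; have [i [k [i0 k0 ->]]] := inQP q.
have -> : (- i%:Z, k%:Z) + (- t%:Z, j%:Z) = (- (i + t)%N%:Z, (k + j)%N%:Z).
  by congr pair => /=; lia.
have [_ _ sb] := elimT (corner_setP op s) sc.
rewrite !XNE //; try lia.
have [im|im] := leqP i (N - t - o).
  rewrite natfun_block //; try lia.
  have -> : (o + (N - t - o - i) = N - (i + t))%N by lia.
  have := sb (N - (i + t))%N; lia.
(* Here i exceeds the size of the block: the position lies before it. *)
apply/negbTE/negP => /andP[h1 /eqP h2].
have := sb (N - (i + t))%N; lia.
Qed.

Definition window_event (D F : {fset Qpt}) (c : int * int) {n : nat}
    (s : 'S_n) : bool :=
  [forall q : D, XN s (val (val q) + c)] &&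
  [forall r : F, ~~ XN s (val (val r) + c)].

Lemma eq_window_event {D F : {fset Qpt}} {c : int * int} {n m : nat}
    {s : 'S_n} {t : 'S_m} :
  (forall q : Qpt, XN s (val q + c) = XN t (val q)) ->
  window_event D F c s = window_event D F 0 t.
Proof.
by move=> e; congr (_ && _); apply: eq_forallb => q; rewrite e addr0.
Qed.

Lemma probN_expect {R : realType} {n : nat} (A : pred 'S_n) :
  probN R A = expectN (fun s : 'S_n => (A s)%:R).
Proof.
rewrite /probN /expectN; congr (_ / _); rewrite -sum1_card natr_sum.
rewrite big_mkcond [RHS]big_mkcond /=; apply: eq_bigr => s _.
by rewrite [in LHS]inE; case: (s \in S312 n); case: (A s).
Qed.

(** * Convergence of the unconditioned probabilities *)

Section Limit.
Context {R : realType} {d : measure_display} {T : measurableType d}.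
Context {P : probability T R} {X : Qpt -> {RV P >-> bool}}.
Context {D F : {fset Qpt}}.

(* The event as a function of the vector of indicators over the union of D and
   F, the form to which convergence in distribution applies. *)
Let g (f : {ffun (D `|` F)%fset -> bool}) : bool :=
  [forall c, ((val c \in D) ==> f c) && ((val c \in F) ==> ~~ f c)].

Let gE (Y : Qpt -> bool) :
  g [ffun c => Y (val c)] = [forall q : D, Y (val q)] && [forall r : F, ~~ Y (val r)].
Proof.
apply/forallP/andP => [h|[/forallP hD /forallP hF] c].
  split; apply/forallP => q.
    have qDF : val q \in (D `|` F)%fset by rewrite inE fsvalP.
    by have := h [` qDF]%fset; rewrite ffunE /= fsvalP => /andP[].
  have qDF : val q \in (D `|` F)%fset by rewrite inE fsvalP orbT.
  by have := h [` qDF]%fset; rewrite ffunE /= fsvalP => /andP[].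
rewrite ffunE; apply/andP; split; apply/implyP => cD.
  exact: (hD [` cD]%fset).
exact: (hF [` cD]%fset).
Qed.

Let limit_set : set T :=
  [set w | (forall q, q \in D -> X q w = true) /\
           (forall r, r \in F -> X r w = false)].

Let limit_setE w : g [ffun c => X (val c) w] = (w \in limit_set).
Proof.
rewrite (gE (fun q => X q w)); apply/andP/idP => [[/forallP hD /forallP hF]|].
  rewrite inE; split=> q qD; first exact: (hD [` qD]%fset).
  exact/negbTE/(hF [` qD]%fset).
rewrite inE => -[hD hF]; split; apply/forallP => q; first by rewrite hD ?fsvalP.
by rewrite hF ?fsvalP.
Qed.

Let measurable_limit_set : measurable limit_set.
Proof.
have -> : limit_set =
    (\bigcap_(q in [set` D]) (X q @^-1` [set true])) `&`
    (\bigcap_(r in [set` F]) (X r @^-1` [set false])).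
  by apply/seteqP; split=> w [hD hF]; split=> q /=;
    [exact: hD|exact: hF|exact: hD|exact: hF].
apply: measurableI; apply: fin_bigcap_measurable => //.
- move=> q _; exact: measurable_funPTI.
- move=> q _; exact: measurable_funPTI.
Qed.

Lemma probN_window_cvg : cvg_in_distribution_XN X ->
  probN R (@window_event D F 0 n) @[n --> \oo] --> fine (P limit_set).
Proof.
move=> /(_ (D `|` F)%fset (fun f => (g f)%:R)) X_limit.
have -> : (fun n => probN R (@window_event D F 0 n)) =
    (fun n => expectN (fun s : 'S_n => (g [ffun q => XN s (val (val q))])%:R)).
  apply/funext => n; rewrite probN_expect; congr expectN; apply/funext => s.
  rewrite (gE (fun q => XN s (val q))).
  by congr (_ && _)%:R; apply: eq_forallb => q; rewrite addr0.
rewrite -(expectation_indic P measurable_limit_set).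
have <- : (fun w => (g [ffun q => X (val q) w])%:R : R) = \1_limit_set.
  by apply/funext => w; rewrite limit_setE.
exact: X_limit.
Qed.

End Limit.

(** * Averaging over the size of the block *)

Lemma cond_probNE {R : realType} {n : nat} (A B : pred 'S_n) :
  cond_probN R A B = #|[set s in S312 n | A s && B s]%SET|%:R /
                     #|[set s in S312 n | B s]%SET|%:R.
Proof.
have S0 : #|S312 n|%:R != 0 :> R by rewrite pnatr_eq0 -lt0n S312_gt0.
by rewrite /cond_probN /probN invf_div mulrACA [_ / _]mulrC mulrA mulfK // mulrC.
Qed.

Lemma card_corner_partition {N : nat} (p b : nat) (A : pred 'S_N) :
  #|[set s in S312 N | A s && (natfun s p == b)]%SET| =
  (\sum_(o < p.+1) #|[set s in corner_set N p b o | A s]%SET|)%N.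
Proof.
rewrite -sum1_card.
rewrite (partition_big
  (fun s => inord (head_length p b (natfun s)) : 'I_p.+1) xpredT) //=.
apply: eq_bigr => o _; rewrite -sum1_card; apply: eq_bigl => s.
rewrite -val_eqE /= inordK ?ltnS ?head_length_le //.
rewrite !finset.in_set.
case: (avoids312 s); case: (A s); case: (natfun s p == b) => /=;
  by rewrite ?andbT ?andbF.
Qed.

(** The witness is the increasing permutation with the value b moved to position
p, all of whose inversions end at p. *)
Lemma corner_nonempty {N p b : nat} : (b <= p)%N -> (p < N)%N ->
  exists2 s : 'S_N, s \in S312 N & natfun s p = b.
Proof.
case: N => // n bp pn; have bn := leq_ltn_trans bp pn.
pose i0 := Ordinal pn; pose j0 := Ordinal bn.
have natfunE k : (k < n.+1)%N -> natfun (lift_perm i0 j0 1) k =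
    if k == p then b else if (b <= k < p)%N then k.+1 else k.
  move=> kn; rewrite (natfun_ord _ (Ordinal kn)).
  have [l e|e] := unliftP i0 (Ordinal kn); rewrite e; last first.
    by rewrite lift_perm_id; move/(congr1 val): e => /= ->; rewrite eqxx.
  rewrite lift_perm_lift perm1 /=; move/(congr1 val): e => /=; rewrite /bump => ->.
  case: (leqP p l); case: (leqP b l) => /= ? ?;
    by case: ifP => ?; try case: ifP => ?; lia.
exists (lift_perm i0 j0 1); last by rewrite natfunE ?eqxx.
apply: S312I => x y z xy yz zn; rewrite !natfunE; [|lia..].
case: (ltngtP x p) => ?; case: (ltngtP y p) => ?; case: (ltngtP z p) => ?;
  try lia.
all: do ![case: ifP => ?]; lia.
Qed.

(** Stated with counts: after division by the number of permutations through the
entry, this says that the conditional probability is within eps of L. *)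
Lemma cond_count_close {R : realType} {D F : {fset Qpt}} {N t j : nat} {L eps : R} :
  (0 < t <= N)%N -> (0 < j)%N ->
  (forall m : nat, (N - t - j <= m)%N ->
    `|L - probN R (@window_event D F 0 m)| <= eps) ->
  `|L * #|[set s in S312 N | natfun s (N - t) == j.-1]%SET|%:R -
    #|[set s in S312 N | window_event D F (- t%:Z, j%:Z) s &&
                         (natfun s (N - t) == j.-1)]%SET|%:R| <=
  eps * #|[set s in S312 N | natfun s (N - t) == j.-1]%SET|%:R.
Proof.
move=> tN j0 close.
have -> : [set s in S312 N | natfun s (N - t) == j.-1]%SET =
    [set s in S312 N | xpredT s && (natfun s (N - t) == j.-1)]%SET by [].
rewrite !card_corner_partition !natr_sum !mulr_sumr -sumrB.
(* It suffices to compare the terms with a given start k of the block. *)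
apply: le_trans (ler_norm_sum _ _ _) _; apply: ler_sum => -[k /= kp] _.
rewrite ltnS in kp.
have -> : [set s in corner_set N (N - t) j.-1 k | xpredT s]%SET =
    corner_set N (N - t) j.-1 k by apply/setP => s; rewrite !inE andbT.
have [->|[s sc]] := set_0Vmem (corner_set N (N - t) j.-1 k).
  rewrite (_ : [set s in _ | _]%SET = finset.set0) ?cards0 ?mulr0 ?subrr ?normr0 //.
  by apply/setP => s; rewrite !inE.
have ob := corner_le kp (@natfun_inj _ s) (elimT (corner_setP kp s) sc).
have pN : (N - t < N)%N by lia.
have : (#|[set s in corner_set N (N - t) j.-1 k |
      window_event D F (- t%:Z, j%:Z) s]%SET| * #|S312 (N - t - k)| =
    #|corner_set N (N - t) j.-1 k| *
      #|[set s in S312 (N - t - k) | window_event D F 0%R s]%SET|)%N.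
  rewrite -(card_block_event kp pN); congr (#|pred_of_set _| * _)%N.
  apply/setP => u; apply/setIdP/setIdP => -[uc uw]; split=> //; move: uw;
  by rewrite (eq_window_event (fun q => XN_block u q tN j0 kp uc)).
move=> /(congr1 (fun i => i%:R : R)); rewrite !natrM => e.
have S0 : #|S312 (N - t - k)|%:R != 0 :> R by rewrite pnatr_eq0 -lt0n S312_gt0.
have -> : #|[set s in corner_set N (N - t) j.-1 k |
      window_event D F (- t%:Z, j%:Z) s]%SET|%:R =
    probN R (@window_event D F 0 (N - t - k)) * #|corner_set N (N - t) j.-1 k|%:R.
  by rewrite /probN mulrAC; apply: (canRL (mulfK S0)); rewrite e mulrC.
rewrite -mulrBl normrM [X in _ * X]ger0_norm ?ler0n //.
by apply: ler_wpM2r; [exact: ler0n | apply: close; lia].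
Qed.

Theorem theorem2p20 (R : realType) (d : measure_display)
    (T : measurableType d) (P : probability T R)
    (X : Qpt -> {RV P >-> bool})
    (X_limit : cvg_in_distribution_XN X)
    (D F : {fset Qpt}) (disjDF : [disjoint D & F]%fset) :
  (let: (N, t, j) := x in
   cond_probN R
     (fun s : 'S_N =>
        [forall q : D, XN s (val (val q) + (- t%:Z, j%:Z))] &&
        [forall r : F, ~~ XN s (val (val r) + (- t%:Z, j%:Z))])
     (fun s : 'S_N => XN s (- t%:Z, j%:Z)))
    @[x --> gap_to_infinity]
  --> fine (P [set w | (forall q, q \in D -> X q w = true) /\
                       (forall r, r \in F -> X r w = false)]).
Proof.
apply/cvgrPdist_le => eps eps0.
have /cvgrPdist_le/(_ _ eps0)[M _ close] := @probN_window_cvg _ _ _ _ _ D F X_limit.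
exists M => // -[[N t] j] /= [N0 t0 j0 gap].
have tN : (0 < t <= N)%N by lia.
rewrite cond_probNE.
have XE (s : 'S_N) : XN s (- t%:Z, j%:Z) = (natfun s (N - t) == j.-1).
  by rewrite XNE // (andP tN).2.
under eq_finset do rewrite XE.
under [X in _ / #|pred_of_set X|%:R]eq_finset do rewrite XE.
have [|//|s sav sp] := @corner_nonempty N (N - t) j.-1; [lia|lia|].
have B0 : 0 < #|[set s in S312 N | natfun s (N - t) == j.-1]%SET|%:R :> R.
  by rewrite ltr0n; apply/card_gt0P; exists s; apply/setIdP; rewrite sp.
rewrite -(ler_pM2r B0) -[X in `|_| * X]ger0_norm ?(ltW B0) //.
rewrite -normrM mulrBl divfK ?gt_eqF //.
by apply: cond_count_close => // m hm; apply: close => /=; lia.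
Qed.
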